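(* Let $\mathscr{X}$ be a real-valued process on $[0,T]\times\Omega$ with all paths continuous and $\mathscr{X}_0>0$, such that for some modulus of continuity function $\rho_{\mathscr{X}}$, $|\mathscr{X}_t(\omega)-\mathscr{X}_t(\omega')|\le\rho_{\mathscr{X}}(\|\omega-\omega'\|_{0,t})$ for all $t\in[0,T]$ and $\omega,\omega'\in\Omega$. Let $$\tau_0=\inf\{t\in[0,T]:\mathscr{X}_t\le0\}\wedge T,\qquad \tau_n=\inf\Big\{t\in[0,T]:\mathscr{X}_t\le\big(\lceil\log_2(n+2)\rceil+\lfloor\mathscr{X}_0^{-1}\rfloor-1\big)^{-1}\Big\}\wedge T,\quad n\in\mathbb{N}.$$ Then there exist an increasing sequence $\{\wp_n\}_{n\in\mathbb{N}}$ in $\mathcal{T}$ and an increasing sequence $\{\kappa_n\}_{n\in\mathbb{N}}$ of positive numbers with $\lim_{n\to\infty}\kappa_n=\infty$ such that for every $n\in\mathbb{N}$: (1) $\tau_n(\omega)\le\wp_n(\omega)\le\tau_0(\omega)$ and $0\le\wp_{n+1}(\omega)-\wp_n(\omega)\le\frac{2T}{n+3}$ for all $\omega\in\Omega$. In particular, if $\{t\in[0,T]:\mathscr{X}_t(\omega')\le0\}$ is not empty for some $\omega'\in\Omega$, then $\wp_n(\omega')<\tau_0(\omega')$. (2) Given $\omega_1,\omega_2\in\Omega$, with $a_n:=\wp_n(\omega_1)\wedge\wp_n(\omega_2)$, the inequality $|\wp_n(\omega_1)-\wp_n(\omega_2)|\le\kappa_n\|\omega_1-\omega_2\|_{0,t_0}$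 holds for every $t_0\in\{t\in[a_n,T):t\ge a_n+\kappa_n\|\omega_1-\omega_2\|_{0,t}\}\cup\{T\}$.
   Context: Fix $d\in\mathbb{N}$, $T\in(0,\infty)$. $\Omega=\{\omega\in C([0,T];\mathbb{R}^d):\omega(0)=0\}$, $\|\omega\|_{0,t}=\sup_{r\in[0,t]}|\omega(r)|$, $B$ is the canonical process, $\mathcal{F}_t=\sigma(B_r:r\in[0,t])$, $\mathbf{F}=\{\mathcal{F}_t\}_{t\in[0,T]}$ is the raw natural filtration, and $\mathcal{T}$ is the set of all $[0,T]$-valued $\mathbf{F}$-stopping times. A modulus of continuity function is a nondecreasing $\rho:[0,\infty)\to[0,\infty)$ with $\lim_{x\downarrow0}\rho(x)=0$. Convention: $\inf\emptyset=\infty$. ''Increasing'' is meant in the weak sense (nondecreasing). The assumption on $\mathscr{X}$ implies $\mathscr{X}$ is $\mathbf{F}$-adapted and that $\mathscr{X}_0$ is a constant. *)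

(* Defs.v *)
From HB Require Import structures.
From mathcomp Require Import all_boot all_order all_algebra.
From mathcomp Require Import all_classical all_reals all_analysis.
Import Order.TTheory GRing.Theory Num.Theory numFieldNormedType.Exports.

Set Implicit Arguments.
Unset Strict Implicit.
Unset Printing Implicit Defensive.

Local Open Scope classical_set_scope.
Local Open Scope ring_scope.

(* The norm MathComp-Analysis puts on 'rV[R]_d is the sup norm, hence this
   explicit Euclidean norm.  The topology on 'rV[R]_d is the usual one. *)
Definition enorm (R : realType) (d : nat) (x : 'rV[R]_d) : R :=
  Num.sqrt (\sum_(i < d) x ord0 i ^+ 2).

(* An element of {w in C([0,T]; R^d) : w(0) = 0} is represented by its
   extension by 0 outside [0,T]; [Omega_out] makes the representative unique. *)
Record Omega (R : realType) (d : nat) (T : R) := MkOmega {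
  Omega_fun :> R -> 'rV[R]_d ;
  Omega_cont : {within `[0, T], continuous Omega_fun} ;
  Omega_start : Omega_fun 0 = 0 ;
  Omega_out : forall t : R, t \notin `[0, T] -> Omega_fun t = 0
}.

Definition supnorm (R : realType) (d : nat) (f : R -> 'rV[R]_d) (t : R) : R :=
  sup [set enorm (f r) | r in `[0, t]].

Definition canonical (R : realType) (d : nat) (T : R) (t : R) (w : Omega d T) :
  'rV[R]_d := w t.

Definition borel (R : realType) (d : nat) : set (set 'rV[R]_d) :=
  <<s [set U : set 'rV[R]_d | open U] >>.

Definition filtration (R : realType) (d : nat) (T t : R) :
    set (set (Omega d T)) :=
  <<s \bigcup_(r in `[0, t])
        preimage_set_system [set: Omega d T] (@canonical R d T r)
          (@borel R d) >>.

Definition stopping_time (R : realType) (d : nat) (T : R)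
    (tau : Omega d T -> R) : Prop :=
  (forall w, 0 <= tau w <= T) /\
  (forall t, 0 <= t <= T ->
     filtration t [set w : Omega d T | tau w <= t]).

Definition modulus_of_continuity (R : realType) (rho : R -> R) : Prop :=
  [/\ forall x, 0 <= x -> 0 <= rho x,
      forall x y, 0 <= x -> x <= y -> rho x <= rho y &
      rho x @[x --> 0^'+] --> (0 : R)].

(* inf {t in [0,T] : X_t(w) <= a} /\ T.  The infimum is taken in \bar R, so that
   inf set0 = +oo; the minimum with T lies in [0,T] and [fine] is harmless. *)
Definition hitting_time (R : realType) (d : nat) (T : R)
    (X : R -> Omega d T -> R) (a : R) (w : Omega d T) : R :=
  fine (Order.min
    (ereal_inf [set t%:E | t in [set t | 0 <= t <= T /\ X t w <= a]])
    T%:E).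

Definition level (R : realType) (x0 : R) (n : nat) : R :=
  ((Num.ceil (ln (n + 2)%:R / ln 2 : R) + Num.floor x0^-1 - 1)%:~R)^-1.

Definition tau_ (R : realType) (d : nat) (T : R) (X : R -> Omega d T -> R)
  (n : nat) (w : Omega d T) : R := hitting_time X (level (X 0 w) n) w.

Definition tau0 (R : realType) (d : nat) (T : R) (X : R -> Omega d T -> R)
  (w : Omega d T) : R := hitting_time X 0 w.

(* Main.v *)
(** The hitting time of a level a is regularized by an inf-convolution over
    paths: the infimum over r and w' with X_r(w') <= a, or
    r = T, of r + K * ||w - w'||_{0,r}.  The result s satisfies
    s(w2) <= s(w1) + K * ||w1 - w2||_{0,s(w1)}, which yields both (2) and the
    stopping time property, since {s <= t} is then closed for the seminorm
    ||.||_{0,t}.  If rho(q) <= b - a and K q >= T, it still lies above the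
    hitting time of b.  Hence a Lipschitz time fits between the hitting times
    of any two consecutive values of the level.  On a dyadic block of n the
    level is constant, and wp_n moves from one such time to the next by
    truncated constant steps, shifted by one index so that the last increment
    of a block is already bounded by the step of the next block. *)

Require Import Defs.
From HB Require Import structures.
From mathcomp Require Import all_boot all_order all_algebra.
From mathcomp Require Import all_classical all_reals all_analysis.
From mathcomp Require Import ring lra.
Import Order.TTheory GRing.Theory Num.Theory numFieldNormedType.Exports.

Set Implicit Arguments.
Unset Strict Implicit.
Unset Printing Implicit Defensive.

Local Open Scope classical_set_scope.
Local Open Scope ring_scope.

(** * Euclidean norm on row vectors *)

Lemma sum_sqr_ge0 (R : realType) (d : nat) (x : 'I_d -> R) :
  0 <= \sum_(i < d) x i ^+ 2.
Proof. by apply: sumr_ge0 => i _; exact: sqr_ge0. Qed.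

Lemma cauchy_schwarz_sum (R : realType) (d : nat) (x y : 'I_d -> R) :
  (\sum_(i < d) x i * y i) ^+ 2 <=
  (\sum_(i < d) x i ^+ 2) * (\sum_(i < d) y i ^+ 2).
Proof.
(* Lagrange's identity *)
have : 0 <= \sum_(i < d) \sum_(j < d) (x i * y j - x j * y i) ^+ 2.
  by apply: sumr_ge0 => i _; apply: sumr_ge0 => j _; exact: sqr_ge0.
suff -> : \sum_(i < d) \sum_(j < d) (x i * y j - x j * y i) ^+ 2 =
   ((\sum_(i < d) x i ^+ 2) * (\sum_(i < d) y i ^+ 2)
    - (\sum_(i < d) x i * y i) ^+ 2) *+ 2.
  by rewrite pmulrn_lge0// subr_ge0.
rewrite expr2 !big_distrlr /= -sumrB.
transitivity (\sum_(i < d) \sum_(j < d)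
  ((x i ^+ 2 * y j ^+ 2 - x i * y i * (x j * y j)) +
   (x j ^+ 2 * y i ^+ 2 - x j * y j * (x i * y i)))).
  by apply: eq_bigr => i _; apply: eq_bigr => j _; ring.
under eq_bigr do rewrite big_split/=.
rewrite big_split/= [X in _ + X]exchange_big/= -mulr2n; congr (_ *+ 2).
by apply: eq_bigr => i _; rewrite sumrB.
Qed.

Section enorm.
Context (R : realType) (d : nat).
Implicit Types x y : 'rV[R]_d.

Lemma enorm_ge0 x : 0 <= enorm x.
Proof. exact: sqrtr_ge0. Qed.

Lemma enorm0 : enorm (0 : 'rV[R]_d) = 0.
Proof.
rewrite /enorm big1 ?sqrtr0// => i _.
by rewrite mxE expr0n.
Qed.

Lemma enormN x : enorm (- x) = enorm x.
Proof. by congr Num.sqrt; apply: eq_bigr => i _; rewrite mxE sqrrN. Qed.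

Lemma ler_enormD x y : enorm (x + y) <= enorm x + enorm y.
Proof.
rewrite -(@ler_pXn2r _ 2) ?nnegrE ?addr_ge0 ?enorm_ge0// sqrrD.
rewrite !sqr_sqrtr ?sum_sqr_ge0//.
under eq_bigr do rewrite mxE sqrrD.
rewrite !big_split/= lerD2r lerD2l. rewrite -mulr2n lerMn2r/=.
rewrite -sqrtrM ?sum_sqr_ge0//.
apply: le_trans (ler_norm _) _.
by rewrite -sqrtr_sqr ler_wsqrtr// cauchy_schwarz_sum.
Qed.

Lemma ler_enorm_norm x : enorm x <= d%:R * `|x|.
Proof.
rewrite -(@ler_pXn2r _ 2) ?nnegrE ?mulr_ge0 ?enorm_ge0//.
rewrite sqr_sqrtr ?sum_sqr_ge0// exprMn.
apply: (@le_trans _ _ (\sum_(i < d) `|x| ^+ 2)).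
  apply: ler_sum => i _; rewrite -[leLHS]real_normK ?num_real//.
  rewrite ler_pXn2r ?nnegrE//.
  by rewrite /Num.norm/= mx_normrE; apply: (le_bigmax _ _ (ord0, i)).
rewrite sumr_const card_ord -[leLHS]mulr_natl ler_wpM2r ?sqr_ge0//.
by rewrite -natrX ler_nat; case: (d) => // n; rewrite expnS leq_pmulr// expn1.
Qed.

End enorm.

(** * Continuity and uniform continuity on a segment *)

Lemma within_continuous_eps (R : realType) (V : normedModType R) (a b : R)
    (f : R -> V) (x e : R) :
  {within `[a, b], continuous f} -> a <= x <= b -> 0 < e ->
  exists2 q : R, 0 < q &
    forall y, a <= y <= b -> `|y - x| < q -> `|f y - f x| < e.
Proof.
move=> /subspace_continuousP cf xab e0.
have /cvgrPdist_lt/(_ e e0) := cf x xab.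
move=> /nbhs_ballP[q /= q0 qe]; exists q => // y yab yx.
rewrite distrC; apply: qe => //.
by rewrite -ball_normE/= distrC.
Qed.

(** Heine-Cantor, from the covering form of compactness: a radius that works near each point can be
    chosen uniformly. *)
Lemma within_continuous_unif (R : realType) (V : normedModType R) (a b : R)
    (f : R -> V) (e : R) :
  {within `[a, b], continuous f} -> 0 < e ->
  exists2 q : R, 0 < q &
    forall x y, a <= x <= b -> a <= y <= b -> `|y - x| < q -> `|f y - f x| < e.
Proof.
move=> cf e0.
have /compact_near_coveringP/near_covering_withinP cpt : compact `[a, b].
  exact: segment_compact.
pose P (q x : R) := forall y, a <= y <= b -> `|y - x| < q -> `|f y - f x| < e.
have := cpt R 0^'+ P _.
case.
  move=> x xab.
  have e20 : 0 < e / 2 by rewrite divr_gt0.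
  have [q q0 qf] := within_continuous_eps cf xab e20.
  have q20 : 0 < q / 2 by rewrite divr_gt0.
  exists ([set y | `|y - x| < q / 2], [set p | p < q / 2]) => /=.
    split.
      by apply/nbhs_ballP; exists (q / 2) => //= y; rewrite /ball/= distrC.
    exact: nbhs_right_lt.
  move=> [y p]/= [yx pq] yab z zab zy.
  rewrite (_ : f z - f y = (f z - f x) - (f y - f x)); last first.
    by rewrite opprB addrA subrK.
  apply: le_lt_trans (ler_normB _ _) _.
  rewrite (splitr e) ltrD// qf//; last by lra.
  rewrite (_ : z - x = (z - y) + (y - x)); last by rewrite addrA subrK.
  by apply: le_lt_trans (ler_normD _ _) _; lra.
move=> q /= q0 qP.
exists (q / 2); first by rewrite divr_gt0.
move=> x y xab yab yx.
have q2 : 0 < q / 2 by rewrite divr_gt0.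
apply: (qP (q / 2)) => //=.
by rewrite sub0r normrN gtr0_norm//; lra.
Qed.

(** * The seminorm distance between paths up to a given time *)

Section pathdist.
Context (R : realType) (d : nat) (T : R).
Implicit Types (w : Omega d T) (r s t : R).

Definition pathdist w1 w2 : R -> R := supnorm (fun r => w1 r - w2 r).

(** The zero extension makes the bound global, so the supremum in [supnorm] is over a bounded set
    for every t, even beyond T. *)
Lemma Omega_bounded w : exists M, forall r, `|w r| <= M.
Proof.
have /compact_bounded :=
  continuous_compact (@Omega_cont _ _ _ w) (@segment_compact _ 0 T).
move=> [M [_ /(_ (M + 1))]]; rewrite ltrDl ltr01 => /(_ isT) wM.
exists (Num.max 0 (M + 1)) => r; rewrite le_max.
have [rT|/negP rT] := boolP (r \in `[0, T]).
  by rewrite (wM (w r)) ?orbT//; exists r.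
by rewrite Omega_out ?normr0 ?lexx//; apply/negP.
Qed.

Lemma continuous_sub_Omega w1 w2 :
  {within `[0, T], continuous (fun r => w1 r - w2 r)}.
Proof. by move=> r; apply: cvgB; [exact: Omega_cont|exact: Omega_cont]. Qed.

Lemma enorm_le_pathdist w1 w2 r t : 0 <= r <= t ->
  enorm (w1 r - w2 r) <= pathdist w1 w2 t.
Proof.
move=> rt; apply: ub_le_sup; last by exists r.
have [M1 wM1] := Omega_bounded w1; have [M2 wM2] := Omega_bounded w2.
exists (d%:R * (M1 + M2)) => _ [s _ <-].
apply: le_trans (ler_enorm_norm _) _; rewrite ler_wpM2l//.
by apply: le_trans (ler_normB _ _) _; rewrite lerD.
Qed.

Lemma pathdist_le w1 w2 t M : 0 <= M ->
  (forall r, 0 <= r <= t -> enorm (w1 r - w2 r) <= M) ->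
  pathdist w1 w2 t <= M.
Proof.
move=> M0 wM; have [t0|t0] := leP 0 t.
  apply: ge_sup.
    by exists (enorm (w1 0 - w2 0)), 0 => //=; rewrite in_itv/= lexx.
  by move=> _ [r rt <-]; apply: wM.
(* For t < 0 the set is empty and [sup] takes its default value 0. *)
rewrite /pathdist /supnorm (_ : [set _ | _ in _] = set0) ?sup0//.
by apply/seteqP; split => // y [r /=]; rewrite in_itv/= => r0t; lra.
Qed.

Lemma pathdist_ge0 w1 w2 t : 0 <= pathdist w1 w2 t.
Proof.
have [t0|t0] := leP 0 t.
  have := @enorm_le_pathdist w1 w2 0 t.
  by rewrite lexx t0 => /(_ isT); apply: le_trans (enorm_ge0 _).
rewrite /pathdist /supnorm (_ : [set _ | _ in _] = set0) ?sup0//.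
by apply/seteqP; split => // y [r /=]; rewrite in_itv/= => r0t; lra.
Qed.

Lemma le_pathdist w1 w2 s t : s <= t -> pathdist w1 w2 s <= pathdist w1 w2 t.
Proof.
move=> st; apply: pathdist_le; first exact: pathdist_ge0.
by move=> r /andP[r0 rs]; apply: enorm_le_pathdist; rewrite r0 (le_trans rs).
Qed.

Lemma pathdistC w1 w2 t : pathdist w1 w2 t = pathdist w2 w1 t.
Proof.
congr sup; apply/seteqP.
by split => _ [r rt <-]; exists r => //; rewrite -enormN opprB.
Qed.

Lemma pathdistxx w t : pathdist w w t = 0.
Proof.
apply/eqP; rewrite eq_le pathdist_ge0 andbT.
by apply: pathdist_le => // r _; rewrite subrr enorm0.
Qed.

Lemma pathdist_triangle w2 w1 w3 t :
  pathdist w1 w3 t <= pathdist w1 w2 t + pathdist w2 w3 t.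
Proof.
apply: pathdist_le; first by rewrite addr_ge0 ?pathdist_ge0.
move=> r rt; rewrite -(subrKA (w2 r)).
apply: le_trans (ler_enormD _ _) _.
by rewrite lerD// enorm_le_pathdist.
Qed.

Lemma pathdist0 w1 w2 : pathdist w1 w2 0 = 0.
Proof.
apply/eqP; rewrite eq_le pathdist_ge0 andbT; apply: pathdist_le => // r.
rewrite -eq_le => /eqP <-.
by rewrite !Omega_start subrr enorm0.
Qed.

Lemma pathdist_right_continuous w1 w2 a e : 0 <= a < T -> 0 < e ->
  exists2 t : R, a < t & pathdist w1 w2 t <= pathdist w1 w2 a + e.
Proof.
move=> /andP[a0 aT] e0.
pose f r := w1 r - w2 r.
have cf : {within `[0, T], continuous f}.
  exact: continuous_sub_Omega.
(* Passing from the sup norm to the Euclidean norm costs a factor d; the denominator d + 1 absorbs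
   it and is never zero. *)
have e'0 : 0 < e / d.+1%:R by rewrite divr_gt0.
have aT' : 0 <= a <= T by rewrite a0 ltW.
have [q q0 fq] := within_continuous_eps cf aT' e'0.
exists (Num.min T (a + q / 2)).
  by rewrite lt_min aT ltrDl divr_gt0.
apply: pathdist_le; first by rewrite addr_ge0 ?pathdist_ge0 ?ltW.
move=> r /andP[r0]; rewrite le_min => /andP[rT raq].
have [ra|ar] := leP r a.
  rewrite -[leLHS]addr0 lerD ?(ltW e0)//.
  by apply: enorm_le_pathdist; rewrite r0.
rewrite -/(f r) -(subrK (f a) (f r)) addrC.
apply: le_trans (ler_enormD _ _) _; apply: lerD.
  by apply: enorm_le_pathdist; rewrite a0 lexx.
apply: le_trans (ler_enorm_norm _) _.
have far : `|f r - f a| <= e / d.+1%:R.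
  by rewrite ltW// fq ?r0//  ger0_norm ?subr_ge0 ?ltW//; lra.
apply: le_trans (ler_wpM2l _ far) _ => //.
rewrite mulrCA ger_pMr// ler_pdivrMr// mul1r.
by rewrite ler_nat.
Qed.

End pathdist.

(** * Countable operations in generated sigma-algebras, and rational approximation *)

Section generated_sigma_algebra.
Context (U : Type) (G : set (set U)).

Lemma sigma_setC (A : set U) : <<s G>> A -> <<s G>> (~` A).
Proof.
have [_ sC _] := @smallest_sigma_algebra _ [set: U] G.
by rewrite -setTD; exact: sC.
Qed.

Lemma sigma_bigcup (I : countType) (P : set I) (F : I -> set U) :
  (forall i, P i -> <<s G>> (F i)) -> <<s G>> (\bigcup_(i in P) F i).
Proof.
have [s0 _ sU] := @smallest_sigma_algebra _ [set: U] G.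
move=> sF; rewrite (_ : \bigcup_(i in P) F i = \bigcup_n
    (if unpickle n is Some i then if `[< P i >] then F i else set0 else set0)).
  apply: sU => n; case: unpickle => [i|//].
  by case: asboolP => // /sF.
apply/seteqP; split=> [x [i Pi Fix]|x [n _]].
  by exists (pickle i) => //; rewrite pickleK; case: asboolP.
by case: unpickle => [i|//]; case: asboolP => // Pi Fix; exists i.
Qed.

Lemma sigma_bigcap (I : countType) (P : set I) (F : I -> set U) :
  (forall i, P i -> <<s G>> (F i)) -> <<s G>> (\bigcap_(i in P) F i).
Proof.
move=> sF; rewrite -[X in <<s _>> X]setCK setC_bigcap; apply: sigma_setC.
by apply: sigma_bigcup => i /sF; exact: sigma_setC.
Qed.

End generated_sigma_algebra.

Lemma closed_norm_ball (R : realType) (V : normedModType R) (c : V) (e : R) :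
  closed [set x | `|x - c| <= e].
Proof.
apply: (closed_comp (f := fun x : V => `|x - c|) (D := [set y | y <= e])).
  by move=> x _; apply: cvg_norm; apply: cvgB; [exact: cvg_id|exact: cvg_cst].
exact: closed_le.
Qed.

Lemma borel_closed_ball (R : realType) (d : nat) (c : 'rV[R]_d) (e : R) :
  @borel R d [set x | `|x - c| <= e].
Proof.
rewrite -[X in borel X]setCK; apply: sigma_setC; apply: sub_sigma_algebra.
rewrite /= openC.
exact: closed_norm_ball.
Qed.

Lemma rat_row_approx (R : realType) (d : nat) (x : 'rV[R]_d) (e : R) :
  0 < e -> exists u : 'rV[rat]_d, `|x - map_mx ratr u| <= e.
Proof.
move=> e0.
have /choice[u ux] : forall i : 'I_d, exists q : rat, `|x ord0 i - ratr q| <= e.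
  move=> i; have xxe : x ord0 i < x ord0 i + e by rewrite ltrDl.
  have [q] := rat_in_itvoo xxe.
  rewrite in_itv/= => xq; exists q; rewrite ler_distlC.
  by apply/andP; split; lra.
exists (\row_i u i); rewrite /Num.norm/= mx_normrE.
apply: bigmax_le => [|[i j] _]; first exact: ltW.
by rewrite !mxE/= ord1 ux.
Qed.

(** * Measurability of sets closed for the seminorm up to time t *)

Section filtration.
Context (R : realType) (d : nat) (T : R).
Implicit Types (w : Omega d T) (t r e : R).

Lemma filtration_closed_ball t r (c : 'rV[R]_d) e : 0 <= r <= t ->
  filtration t [set w : Omega d T | `|w r - c| <= e].
Proof.
move=> rt; apply: sub_sigma_algebra; exists r => //.
exists [set x | `|x - c| <= e]; first exact: borel_closed_ball.
by rewrite setTI.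
Qed.

(* Rational times are dense in [0, t] only if 0 < t or t is rational, hence
   the extra time t. *)
Definition tube_time t (q : option rat) : R :=
  if q is Some q then ratr q else t.

(** A countable family of balls around step functions of mesh 1/(m+1) with rational values listed in
    [v]; testing only countably many times makes each ball measurable. *)
Definition tube t (i : nat * nat * seq 'rV[rat]_d) : set (Omega d T) :=
  let: (m, k, v) := i in
  \bigcap_(q in [set q | 0 <= tube_time t q <= t])
    [set w | `|w (tube_time t q)
               - map_mx ratr (nth 0 v (Num.truncn (tube_time t q * m.+1%:R)))|
             <= k.+1%:R^-1].

Lemma tube_measurable t i : filtration t (tube t i).
Proof.
move: i => [[m k] v]; apply: sigma_bigcap => q tq.
exact: filtration_closed_ball.
Qed.

(** Two paths near the same step function at the tested times are near each other there; continuity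
    carries the bound to every r < t through rational times just to the right of r. *)
Lemma tube_diameter t m k v w1 w2 : t <= T ->
  tube t (m, k, v) w1 -> tube t (m, k, v) w2 ->
  pathdist w1 w2 t <= d%:R * (2 / k.+1%:R).
Proof.
move=> tT A1 A2; apply: pathdist_le; first by rewrite mulr_ge0 ?divr_ge0.
have close q : 0 <= tube_time t q <= t ->
    `|w1 (tube_time t q) - w2 (tube_time t q)| <= 2 / k.+1%:R.
  move=> tq; have := A1 q tq; have := A2 q tq => /=.
  set c := map_mx _ _; rewrite (distrC _ c) => w2c w1c.
  rewrite -(subrKA c); apply: le_trans (ler_normD _ _) _.
  by rewrite mulr_natl mulr2n lerD.
move=> r /andP[r0 rt]; apply: le_trans (ler_enorm_norm _) _.
rewrite ler_wpM2l//.
have [->|rNt] := eqVneq r t; first by apply: (close None); rewrite /= lexx (le_trans r0).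
have {rNt}rt' : r < t by rewrite lt_neqAle rNt.
apply/ler_addgt0Pr => e e0.
pose f s := w1 s - w2 s.
have cf : {within `[0, T], continuous f}.
  exact: continuous_sub_Omega.
have rT : 0 <= r <= T by rewrite r0 (le_trans rt).
have [q q0 fq] := within_continuous_eps cf rT e0.
have rtq : r < Num.min t (r + q) by rewrite lt_min rt' ltrDl.
have [s] := rat_in_itvoo rtq.
rewrite in_itv/= lt_min => /and3P[rs st sq].
have := close (Some s); rewrite /= (ltW st) (le_trans r0 (ltW rs)) => /(_ isT) fs.
rewrite -/(f r) -(subrK (f (ratr s)) (f r)) addrC.
apply: le_trans (ler_normD _ _) _; rewrite lerD//.
rewrite distrC ltW// fq//; first by rewrite (le_trans r0 (ltW rs)) (le_trans (ltW st)).
by rewrite ger0_norm; lra.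
Qed.

(** The path is sampled at multiples of 1/(m+1): half of the tolerance pays for the oscillation on a
    mesh cell, half for rounding the sample to a rational vector. *)
Lemma tube_cover t k w : t <= T -> exists m v, tube t (m, k, v) w.
Proof.
move=> tT.
have e0 : 0 < k.+1%:R^-1 / 2 :> R by rewrite divr_gt0 ?invr_gt0.
have [q q0 wq] := within_continuous_unif (@Omega_cont _ _ _ w) e0.
pose m := Num.truncn q^-1.
have mq : m.+1%:R^-1 < q.
  rewrite invf_plt ?posrE//. exact: truncnS_gt.
have /choice[u ux] : forall j : nat, exists u : 'rV[rat]_d,
    `|w (j%:R / m.+1%:R) - map_mx ratr u| <= k.+1%:R^-1 / 2.
  by move=> j; exact: rat_row_approx.
exists m, (mkseq u (Num.truncn (t * m.+1%:R)).+1) => p /= /andP[].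
move: (tube_time t p) => r r0 rt.
set j := Num.truncn (r * m.+1%:R).
have jr : j%:R <= r * m.+1%:R < j.+1%:R.
  by apply: truncn_itv; rewrite mulr_ge0.
rewrite nth_mkseq ?ltnS ?le_truncn ?ler_wpM2r//.
rewrite -(subrKA (w (j%:R / m.+1%:R))).
apply: le_trans (ler_normD _ _) _; rewrite [leRHS]splitr lerD//.
have [jr1 jr2] := andP jr.
have jr' : j%:R / m.+1%:R <= r by rewrite ler_pdivrMr.
have rj : r < j%:R / m.+1%:R + m.+1%:R^-1.
  by rewrite -[X in _ + X]mul1r -mulrDl natr1 ltr_pdivlMr.
rewrite ltW// wq//.
- by rewrite divr_ge0// (le_trans jr')// (le_trans rt).
- by rewrite r0 (le_trans rt).
- by rewrite ger0_norm ?subr_ge0// ltrBlDl (lt_trans rj)// ltrD2l.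
Qed.

(** The complement of C is open for the seminorm, hence the union of the countably many tubes that
    it contains, because tubes of arbitrarily small diameter cover all paths. *)
Lemma filtration_closed t (C : set (Omega d T)) : t <= T ->
  (forall w, ~ C w -> exists2 e : R, 0 < e &
     forall w', pathdist w w' t < e -> ~ C w') ->
  filtration t C.
Proof.
move=> tT clC; rewrite -[C]setCK; apply: sigma_setC.
rewrite (_ : ~` C = \bigcup_(i in [set i | tube t i `<=` ~` C]) tube t i).
  by apply: sigma_bigcup => i _; exact: tube_measurable.
apply/seteqP; split=> [w Cw|w [i]]; last exact.
have [e e0 we] := clC w Cw.
pose k := Num.truncn (d%:R * 2 / e).
have ke : d%:R * (2 / k.+1%:R) < e.
  rewrite mulrA ltr_pdivrMr// [ltRHS]mulrC -ltr_pdivrMr//; exact: truncnS_gt.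
have [m [v Aw]] := tube_cover k w tT.
exists (m, k, v) => // w' Aw'; apply: we.
exact: le_lt_trans (tube_diameter tT Aw Aw') ke.
Qed.

End filtration.

(** * Causal Lipschitz times *)

Section causal_lipschitz.
Context (R : realType) (d : nat) (T : R).
Implicit Types (s : Omega d T -> R) (K c : R).

(* A random time that is Lipschitz in the path only sees the path up to the
   time itself; this is what makes it a raw stopping time. *)
Definition causal_lipschitz K s :=
  forall w1 w2, s w2 <= s w1 + K * pathdist w1 w2 (s w1).

Lemma causal_lipschitz_le K K' s : K <= K' ->
  causal_lipschitz K s -> causal_lipschitz K' s.
Proof.
move=> KK' sK w1 w2; apply: le_trans (sK w1 w2) _.
by rewrite lerD2l ler_wpM2r ?pathdist_ge0.
Qed.

Lemma causal_lipschitz_min K s s' :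
  causal_lipschitz K s -> causal_lipschitz K s' ->
  causal_lipschitz K (fun w => Num.min (s w) (s' w)).
Proof.
move=> sK s'K w1 w2; rewrite ge_min.
by case: (leP (s w1) (s' w1)) => _; rewrite ?sK ?s'K ?orbT.
Qed.

Lemma causal_lipschitzD K c s : 0 <= K -> 0 <= c ->
  causal_lipschitz K s -> causal_lipschitz K (fun w => s w + c).
Proof.
move=> K0 c0 sK w1 w2; rewrite addrAC lerD2r.
apply: le_trans (sK w1 w2) _.
by rewrite lerD2l ler_wpM2l// le_pathdist// lerDl.
Qed.

(** If s w > t and s w' <= t, the property from w' to w gives s w - t <= K ||w - w'||_{0,t}; so the
    paths with s > t form an open set. *)
Lemma causal_lipschitz_stopping_time K s : 0 <= K ->
  (forall w, 0 <= s w <= T) -> causal_lipschitz K s -> stopping_time s.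
Proof.
move=> K0 sT sK; split=> // t /andP[t0 tT]; apply: filtration_closed => //= w.
move=> /negP; rewrite -ltNge => tsw.
have K10 : 0 < K + 1 by rewrite ltr_wpDl.
exists ((s w - t) / (K + 1)); first by rewrite divr_gt0 ?subr_gt0.
move=> w'; rewrite ltr_pdivlMr// => ww' sw't.
have := sK w' w; apply/negP; rewrite -ltNge.
have := le_pathdist w w' sw't; rewrite (pathdistC w' w).
have := pathdist_ge0 w w' t; nra.
Qed.

(** The property is applied from the path whose time comes first, so the seminorm is read at the
    minimum; this yields (2). *)
Lemma causal_lipschitz_dist K s w1 w2 t : 0 <= K -> causal_lipschitz K s ->
  Num.min (s w1) (s w2) <= t -> `|s w1 - s w2| <= K * pathdist w1 w2 t.
Proof.
move=> K0 sK; wlog s12 : w1 w2 / s w1 <= s w2.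
  move=> h; have /orP[/h//|s21] := le_total (s w1) (s w2).
  by rewrite minC distrC pathdistC; exact: h.
rewrite (min_idPl s12) => s1t; rewrite distrC ger0_norm ?subr_ge0// lerBlDl.
apply: le_trans (sK w1 w2) _.
by rewrite lerD2l ler_wpM2l// le_pathdist.
Qed.

End causal_lipschitz.

(** * Hitting times and their Lipschitz regularization *)

Section hitting_time.
Context (R : realType) (d : nat) (T : R) (T_ge0 : 0 <= T).
Context (X : R -> Omega d T -> R).
Implicit Types (w : Omega d T) (a t y K : R).

(** Here and in the next lemma the minimum lies between two finite values, so [fine] preserves the
    order. *)
Lemma le_hitting_time a w y : y <= T ->
  (forall t, 0 <= t <= T -> X t w <= a -> y <= t) -> y <= hitting_time X a w.
Proof.
move=> yT yX; rewrite /hitting_time.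
set m := Order.min _ _.
have ym : (y%:E <= m)%E.
  rewrite le_min lee_fin yT andbT; apply: le_ereal_inf_tmp => _ [t [tT Xt] <-].
  by rewrite lee_fin yX.
have mT : (m <= T%:E)%E by rewrite ge_min lexx orbT.
rewrite -lee_fin fineK// fin_numE.
by apply/andP; split; apply/eqP => mE; rewrite mE in ym mT.
Qed.

Lemma hitting_time_le a w t : 0 <= t <= T -> X t w <= a ->
  hitting_time X a w <= t.
Proof.
move=> tT Xt; rewrite /hitting_time.
set m := Order.min _ _.
have mt : (m <= t%:E)%E.
  by rewrite ge_min; apply/orP; left; apply: ereal_inf_lbound; exists t.
have m0 : (0%:E <= m)%E.
  rewrite le_min lee_fin T_ge0 andbT; apply: le_ereal_inf_tmp => _ [r [/andP[r0 _] _] <-].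
  by rewrite lee_fin.
rewrite -lee_fin fineK// fin_numE.
by apply/andP; split; apply/eqP => mE; rewrite mE in mt m0.
Qed.

Lemma hitting_time_leT a w : hitting_time X a w <= T.
Proof.
rewrite /hitting_time; set m := Order.min _ _.
have mT : (m <= T%:E)%E by rewrite ge_min lexx orbT.
by case: m mT => [m||] //=; rewrite ?lee_fin.
Qed.

Lemma le_hitting_time_level a b w : b <= a ->
  hitting_time X a w <= hitting_time X b w.
Proof.
move=> ba; apply: le_hitting_time; first exact: hitting_time_leT.
by move=> t tT Xt; apply: hitting_time_le => //; exact: le_trans ba.
Qed.

(** Admitting r = T for any path builds the truncation at T into the infimum and keeps the set
    nonempty. *)
Definition lipschitz_hitting_set K a w : set R :=
  [set y | exists r w', [/\ 0 <= r <= T, X r w' <= a \/ r = T &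
     y = r + K * pathdist w w' r]].

Definition lipschitz_hitting K a w : R := inf (lipschitz_hitting_set K a w).

Lemma lipschitz_hitting_setT K a w : lipschitz_hitting_set K a w T.
Proof.
exists T, w; split; [by rewrite T_ge0 lexx|by right|].
by rewrite pathdistxx mulr0 addr0.
Qed.

Lemma le_lipschitz_hitting K a w y :
  (forall r w', 0 <= r <= T -> X r w' <= a \/ r = T ->
     y <= r + K * pathdist w w' r) -> y <= lipschitz_hitting K a w.
Proof.
move=> yX; apply: lb_le_inf; first by exists T; exact: lipschitz_hitting_setT.
by move=> _ [r [w' [rT rX ->]]]; exact: yX.
Qed.

Lemma lipschitz_hitting_le K a w w' r : 0 <= K -> 0 <= r <= T ->
  X r w' <= a \/ r = T -> lipschitz_hitting K a w <= r + K * pathdist w w' r.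
Proof.
move=> K0 rT rX; apply: ge_inf; last by exists r, w'.
exists 0 => _ [t [w'' [/andP[t0 _] _ ->]]].
by rewrite addr_ge0 ?mulr_ge0 ?pathdist_ge0.
Qed.

Lemma lipschitz_hitting_ge0 K a w : 0 <= K -> 0 <= lipschitz_hitting K a w.
Proof.
move=> K0; apply: le_lipschitz_hitting => r w' /andP[r0 _] _.
by rewrite addr_ge0 ?mulr_ge0 ?pathdist_ge0.
Qed.

Lemma lipschitz_hitting_le_hitting K a w : 0 <= K ->
  lipschitz_hitting K a w <= hitting_time X a w.
Proof.
move=> K0; apply: le_hitting_time => [|t tT Xt].
  have := @lipschitz_hitting_le K a w w T K0.
  by rewrite pathdistxx mulr0 addr0 T_ge0 lexx; apply => //; right.
have := @lipschitz_hitting_le K a w w t K0 tT.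
by rewrite pathdistxx mulr0 addr0; apply; left.
Qed.

(** A near-minimizer (r, w') for w1 also competes for w2, at an extra cost K ||w1 - w2||_{0,r} by
    the triangle inequality. Since r may exceed s, right continuity of the seminorm brings r back to
    s. *)
Lemma lipschitz_hitting_causal K a : 0 <= K ->
  causal_lipschitz K (lipschitz_hitting K a).
Proof.
move=> K0 w1 w2; set s := lipschitz_hitting K a w1.
have s0 : 0 <= s by exact: lipschitz_hitting_ge0.
have [Ts|sT] := leP T s.
  apply: le_trans (_ : T <= _); last first.
    by rewrite (le_trans Ts)// lerDl mulr_ge0// pathdist_ge0.
  exact: le_trans (lipschitz_hitting_le_hitting _ _ K0) (hitting_time_leT _ _).
apply/ler_addgt0Pr => e e0.
have K10 : 0 < K + 1 by rewrite ltr_wpDl.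
have e'0 : 0 < e / 2 / (K + 1) by rewrite !divr_gt0.
have sT' : 0 <= s < T by rewrite s0.
have [t st dt] := pathdist_right_continuous w1 w2 sT' e'0.
(* A value below t forces r < t, and a value below s + e/2 leaves the other e/2 for right
   continuity. *)
have [_ [r [w' [rT rX ->]]] rs] :
    exists2 y, lipschitz_hitting_set K a w1 y & y < Num.min t (s + e / 2).
  apply: inf_lt; last by rewrite lt_min st ltrDl divr_gt0.
  by exists T; exact: lipschitz_hitting_setT.
move: rs; rewrite lt_min => /andP[rt rs].
have rt' : r <= t.
  by apply: le_trans (ltW rt); rewrite lerDl mulr_ge0 ?pathdist_ge0.
apply: le_trans (lipschitz_hitting_le w2 K0 rT rX) _.
have h1 : K * pathdist w2 w' r <= K * (pathdist w1 w2 r + pathdist w1 w' r).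
  by rewrite ler_wpM2l// (pathdistC w1 w2) pathdist_triangle.
have h2 : K * pathdist w1 w2 r <= K * (pathdist w1 w2 s + e / 2 / (K + 1)).
  by rewrite ler_wpM2l// (le_trans _ dt)// le_pathdist.
have h3 : K * (e / 2 / (K + 1)) <= e / 2.
  by rewrite mulrCA ger_pMr ?divr_gt0// ler_pdivrMr// mul1r lerDl.
lra.
Qed.

(* A path w' that reaches a before w reaches b > a is at distance at least q
   from w by then, which costs K * q >= T. *)
Lemma hitting_le_lipschitz_hitting (rho : R -> R) K a b q w :
  (forall x y, 0 <= x -> x <= y -> rho x <= rho y) ->
  (forall t w w', 0 <= t <= T -> `|X t w - X t w'| <= rho (pathdist w w' t)) ->
  0 < q -> rho q <= b - a -> T <= K * q ->
  hitting_time X b w <= lipschitz_hitting K a w.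
Proof.
move=> rho_mono X_rho q0 rhoq TK; apply: le_lipschitz_hitting => r w' rT rX.
have K0 : 0 <= K by rewrite -(pmulr_lge0 _ q0) (le_trans T_ge0).
have [r0 _] := andP rT.
have K_ge0 : 0 <= K * pathdist w w' r by rewrite mulr_ge0 ?pathdist_ge0.
have [qd|dq] := leP q (pathdist w w' r).
  apply: le_trans (hitting_time_leT _ _) _; apply: (le_trans TK).
  by rewrite -[leLHS]add0r lerD// ler_wpM2l.
case: rX => [Xr|->]; last first.
  by apply: le_trans (hitting_time_leT _ _) _; rewrite lerDl mulr_ge0 ?pathdist_ge0.
apply: (@le_trans _ _ r); last by rewrite lerDl.
apply: hitting_time_le => //.
have := X_rho r w w' rT; have := rho_mono _ _ (pathdist_ge0 w w' r) (ltW dq).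
by rewrite ler_distlC => ? /andP[]; lra.
Qed.

End hitting_time.

(** By continuity X is at most b at its hitting time of b; that time is positive because X starts
    above b, so X is already below a a little earlier. *)
Lemma hitting_time_lt (R : realType) (d : nat) (T : R)
    (X : R -> Omega d T -> R) (w : Omega d T) (a b : R) : 0 <= T -> b < a ->
  {within `[0, T], continuous (X ^~ w)} -> b < X 0 w ->
  (exists t : R, 0 <= t <= T /\ X t w <= b) ->
  hitting_time X a w < hitting_time X b w.
Proof.
move=> T0 ba Xc X0 [t [tT Xt]]; set s := hitting_time X b w.
have st : s <= t by exact: hitting_time_le.
have s0 : 0 <= s by apply: le_hitting_time => // r /andP[].
have sT : 0 <= s <= T by rewrite s0 (le_trans st)//; case/andP: tT.
have Xs : X s w <= b.
  rewrite leNgt; apply/negP => bXs.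
  have bXs' : 0 < X s w - b by rewrite subr_gt0.
  have [q q0 Xq] := within_continuous_eps Xc sT bXs'.
  (* If X were above b at s, it would stay so up to T or s + q, and the hitting time would be at
     least their minimum. This forces t = s, contradicting the hit at t. *)
  suff : Num.min T (s + q) <= s.
    rewrite ge_min gerDl [q <= 0]leNgt q0 orbF => Ts; have tsE : t = s.
      by apply/eqP; rewrite eq_le st (le_trans _ Ts)//; case/andP: tT.
    by move: Xt; rewrite tsE leNgt bXs.
  apply: le_hitting_time; first by rewrite ge_min lexx.
  move=> r rT Xr; rewrite leNgt; apply/negP; rewrite lt_min => /andP[_ rsq].
  have sr : s <= r by exact: hitting_time_le.
  have := Xq r rT; rewrite ger0_norm ?subr_ge0// ltrBlDl => /(_ rsq).
  by rewrite ltr_distlC => /andP[]; lra.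
have s_gt0 : 0 < s.
  by rewrite lt_neqAle s0 andbT; apply: contraTneq X0 => ->; rewrite -leNgt.
have ab' : 0 < a - b by rewrite subr_gt0.
have [q q0 Xq] := within_continuous_eps Xc sT ab'.
pose r : R := Num.max 0 (s - q / 2).
have rs : r < s by rewrite gt_max s_gt0 ltrBlDr ltrDl divr_gt0.
have rT : 0 <= r <= T.
  by rewrite le_max lexx/= (le_trans (ltW rs))//; case/andP: sT.
apply: le_lt_trans (rs); apply: hitting_time_le => //.
have : s - q / 2 <= r by rewrite le_max lexx orbT.
move=> sqr; have := Xq r rT.
rewrite [`|r - s|]distrC ger0_norm ?subr_ge0 ?(ltW rs)// ltrBlDl.
rewrite (_ : s < r + q); last by lra.
by move=> /(_ isT); rewrite distrC ltr_distlC => /andP[]; lra.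
Qed.

(** * Dyadic levels and interpolation between successive times *)

(** Both sides are the k with 2^(k-1) < m <= 2^k. *)
Lemma ceil_log2 (R : realType) (m : nat) : (1 < m)%N ->
  Num.ceil (ln m%:R / ln 2 : R) = up_log 2 m.
Proof.
move=> m1; have m0 : (0 < m)%N by exact: ltnW.
have ln2 : 0 < ln 2 :> R by rewrite ln_gt0 ?ltr1n.
have lnX k : ln (2 ^ k)%:R = k%:R * ln 2 :> R.
  by rewrite natrX lnXn// mulr_natl.
have k0 : (0 < up_log 2 m)%N by rewrite up_log_gt0.
apply: ceil_def; apply/andP; split.
  rewrite ltr_pdivlMr// -[(up_log 2 m)](prednK k0) -addn1 PoszD addrK.
  rewrite -[X in X * _]/((up_log 2 m).-1%:R) -lnX ltr_ln ?posrE ?ltr0n ?expn_gt0//.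
  by rewrite ltr_nat up_log_gtn.
rewrite ler_pdivrMr// -[X in X * _]/((up_log 2 m)%:R) -lnX.
by rewrite ler_ln ?posrE ?ltr0n ?expn_gt0// ler_nat up_logP.
Qed.

Section block_level.
Context (R : realType) (x0 : R) (x0_gt0 : 0 < x0).

(** The level as a function of the block number k = ceil(log2(n + 2)). *)
Definition block_level (k : nat) : R :=
  ((k%:Z + Num.floor x0^-1 - 1)%:~R)^-1.

Lemma levelE n : level x0 n = block_level (up_log 2 (n + 2)).
Proof. by rewrite /level ceil_log2// addn2. Qed.

(** From k = 2 on the integer k + floor(1/x0) - 1 is at least 1; the blocks of n >= 1 start at k =
    2. *)
Lemma block_level_gt0 k : (2 <= k)%N -> 0 < block_level k.
Proof.
move=> k2; rewrite invr_gt0 ltr0z subr_gt0.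
have : 0 <= Num.floor x0^-1 by rewrite floor_ge0 invr_ge0 ltW.
by move=> f0; apply: (@lt_le_trans _ _ k%:Z); [rewrite ltz_nat|rewrite lerDl].
Qed.

Lemma block_level_lt k : (2 <= k)%N -> block_level k.+1 < block_level k.
Proof.
move=> k2; have := block_level_gt0 k2.
have /block_level_gt0 : (2 <= k.+1)%N by exact: leqW.
rewrite /block_level !invr_gt0 => h1 h2.
by rewrite ltf_pV2 ?posrE// ltr_int ltrD2r ltrD2r ltz_nat.
Qed.

End block_level.

Section dyadic_interpolation.
Context (R : realType) (T : R) (T_gt0 : 0 < T) (s : nat -> R).

(* With m in (2^k, 2^(k+1)], it moves from s (k + 1) to s (k + 2) in steps of
   length at most T / 2^k. *)
Definition dyadic_interpolation (m : nat) : R :=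
  let k := (up_log 2 m).-1 in
  Num.min (s k.+1 + (m - 2 ^ k)%:R * (T / (2 ^ k)%:R)) (s k.+2).

Lemma dyadic_interpolation_ge m : s (up_log 2 m).-1.+1 <= s (up_log 2 m).-1.+2 ->
  s (up_log 2 m).-1.+1 <= dyadic_interpolation m.
Proof.
move=> ss; rewrite le_min ss andbT lerDl mulr_ge0 ?ler0n//.
by rewrite divr_ge0 ?ler0n// ltW.
Qed.

Lemma dyadic_interpolation_step m : (2 < m)%N ->
  (forall k, (2 <= k)%N -> s k <= s k.+1) ->
  (forall k, (2 <= k)%N -> 0 <= s k <= T) ->
  0 <= dyadic_interpolation m.+1 - dyadic_interpolation m <= 2 * T / m.+1%:R.
Proof.
move=> m2 s_le sT; have m1 : (1 < m)%N by exact: ltnW.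
have kE : up_log 2 m = (up_log 2 m).-1.+1 by rewrite prednK// up_log_gt0.
have := up_logP m (isT : (1 < 2)%N); have := up_log_gtn (isT : (1 < 2)%N) m1.
rewrite /dyadic_interpolation; move: kE; set k := (up_log 2 m).-1 => kE.
have k1 : (1 <= k)%N.
  rewrite -ltnS -kE ltnNge; apply/negP => km.
  have := up_logP m (isT : (1 < 2)%N); rewrite leqNgt => /negP; apply.
  by apply: leq_ltn_trans m2; rewrite -[leqRHS]expn1 leq_exp2l.
rewrite kE => pm mp.
set p := (2 ^ k)%N in pm mp *.
have p0 : 0 < p%:R :> R by rewrite ltr0n expn_gt0.
have Tp0 : 0 < T / p%:R by rewrite divr_gt0.
have mp' : (m <= p * 2)%N by rewrite -expnSr.
have s12 := s_le k.+1 k1; have s23 := s_le k.+2 isT.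
have /andP[s1 s1T] := sT k.+1 k1; have /andP[s2 s2T] := sT k.+2 isT.
have m10 : 0 < m.+1%:R :> R by [].
(* If m = 2^(k+1) ends its block, the 2^k steps add up to T, so the truncation has reached s (k +
   2), where the next block starts with step T / m. *)
move: mp'; rewrite leq_eqVlt => /orP[/eqP mE|mlt].
  have mS : (m < p * 2 * 2)%N.
    by rewrite -mE ltn_Pmulr// ltnW.
  have -> : up_log 2 m.+1 = k.+2.
    by apply: up_log_eq => //; rewrite !expnSr -/p mS ltnS mE leqnn.
  rewrite /= expnSr -/p -mE subSnn mul1r.
  have -> : (m - p)%N = p by rewrite mE muln2 -addnn addnK.
  have -> : p%:R * (T / p%:R) = T by rewrite mulrC divfK ?gt_eqF.
  rewrite (@min_idPr _ _ (_ + T) _ _); last by lra.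
  have Tm0 : 0 < T / m%:R by rewrite divr_gt0// ltr0n ltnW// ltnW.
  have Tm : T / m%:R <= 2 * T / m.+1%:R.
    rewrite ler_pdivrMr ?ltr0n ?(ltnW (ltnW m2))// mulrAC ler_pdivlMr//.
    have m1' : 0 <= T * (m%:R - 1) by rewrite mulr_ge0 ?(ltW T_gt0)// subr_ge0 ler1n ltnW.
    by rewrite -natr1; lra.
  move: Tm0 Tm; set u := T / m%:R; set z := 2 * T / m.+1%:R => Tm0 Tm.
  by case: (leP (s k.+2 + u) (s k.+3)) => h; apply/andP; split; lra.
(* Otherwise m + 1 is in the same block and at most 2^(k+1), so the step T / 2^k is at most 2 T / (m
   + 1). *)
have -> : up_log 2 m.+1 = k.+1.
  by apply: up_log_eq => //; rewrite expnSr -/p ltnS (ltnW pm).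
rewrite /= -/p.
have -> : ((m.+1 - p)%:R = (m - p)%:R + 1 :> R).
  by rewrite subSn ?(ltnW pm)// -natr1.
have Tm : T / p%:R <= 2 * T / m.+1%:R.
  rewrite ler_pdivrMr// mulrAC ler_pdivlMr//.
  have mp2 : 0 <= T * (p%:R * 2 - m.+1%:R).
    by rewrite mulr_ge0 ?(ltW T_gt0)// subr_ge0 -natrM ler_nat.
  lra.
rewrite mulrDl mul1r; move: Tp0 Tm.
set u := T / p%:R; set v := _ * u; set z := 2 * T / m.+1%:R => Tp0 Tm.
case: (leP (s k.+1 + v) (s k.+2)) => h1;
  case: (leP (s k.+1 + (v + u)) (s k.+2)) => h2;
  by apply/andP; split; lra.
Qed.

End dyadic_interpolation.

(** * Moduli of continuity and construction of the two sequences *)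

Lemma modulus_of_continuity_small (R : realType) (rho : R -> R) (e : R) :
  modulus_of_continuity rho -> 0 < e -> exists2 q : R, 0 < q & rho q <= e.
Proof.
move=> [_ _ rho0] e0; have /cvgrPdist_lt/(_ e e0) := rho0.
move=> /(filterI (nbhs_right_gt (0 : R))) /filter_ex[q /= [q0]].
by rewrite sub0r normrN => qe; exists q => //; exact: le_trans (ler_norm _) (ltW qe).
Qed.

Lemma modulus_of_continuity0 (R : realType) (rho : R -> R) :
  modulus_of_continuity rho -> rho 0 = 0.
Proof.
move=> rhom; have [rho_ge0 rho_mono _] := rhom.
apply/eqP; rewrite eq_le rho_ge0// andbT; apply/ler_addgt0Pr => e e0.
have [q q0 qe] := modulus_of_continuity_small rhom e0.
by rewrite add0r (le_trans _ qe)// rho_mono// ltW.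
Qed.

Definition Omega0 (R : realType) (d : nat) (T : R) : Omega d T :=
  MkOmega (continuous_subspaceT (@cst_continuous _ _ (0 : 'rV[R]_d)))
    erefl (fun _ _ => erefl).

Theorem proposition5p1 (R : realType) (d : nat) (T : R)
    (d_gt0 : (0 < d)%N) (T_gt0 : 0 < T)
    (X : R -> Omega d T -> R)
    (X_cont : forall w : Omega d T, {within `[0, T], continuous (X ^~ w)})
    (X0_gt0 : forall w : Omega d T, 0 < X 0 w)
    (rho : R -> R) (rho_mod : modulus_of_continuity rho)
    (X_rho : forall (t : R) (w w' : Omega d T), 0 <= t <= T ->
       `|X t w - X t w'| <= rho (supnorm (fun r => w r - w' r) t)) :
  exists (wp : nat -> Omega d T -> R) (kappa : nat -> R),
    [/\ forall n, (1 <= n)%N -> stopping_time (wp n),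
        forall m n w, (1 <= m)%N -> (m <= n)%N -> wp m w <= wp n w,
        forall n, (1 <= n)%N -> 0 < kappa n,
        forall m n, (1 <= m)%N -> (m <= n)%N -> kappa m <= kappa n &
        kappa n @[n --> \oo] --> +oo] /\
    forall n, (1 <= n)%N ->
      [/\ forall w, tau_ X n w <= wp n w <= tau0 X w,
          forall w, 0 <= wp n.+1 w - wp n w <= 2 * T / (n + 3)%:R,
          forall w', (exists t, 0 <= t <= T /\ X t w' <= 0) ->
            wp n w' < tau0 X w' &
          forall (w1 w2 : Omega d T) (t0 : R),
            let a := Order.min (wp n w1) (wp n w2) in
            let N := supnorm (fun r => w1 r - w2 r) in
            (a <= t0 < T /\ a + kappa n * N t0 <= t0) \/ t0 = T ->
            `|wp n w1 - wp n w2| <= kappa n * N t0].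
Proof.
have T_ge0 := ltW T_gt0; have [rho_ge0 rho_mono _] := rho_mod.
pose x0 := X 0 (Omega0 d T).
have x0_gt0 : 0 < x0 by exact: X0_gt0.
(* All paths start at 0, so their seminorm distance at time 0 vanishes and X_0 is constant. *)
have X0E w : X 0 w = x0.
  apply/eqP; rewrite -subr_eq0 -normr_eq0 eq_le normr_ge0 andbT.
  have := X_rho 0 w (Omega0 d T); rewrite lexx T_ge0 => /(_ isT).
  by rewrite -/(pathdist _ _ _) pathdist0 modulus_of_continuity0.
pose lev := block_level x0.
have lev_gt0 := block_level_gt0 x0_gt0; have lev_lt := block_level_lt x0_gt0.
(* Paths within q k of each other change X by at most the gap between levels k and k + 1. For k < 2
   the value 1 is a dummy. *)
have /choice[q qP] : forall k, exists q : R, 0 < q /\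
    ((2 <= k)%N -> rho q <= lev k - lev k.+1).
  move=> k; have [k2|] := boolP (2 <= k)%N; last by exists 1.
  have lev_gap : 0 < lev k - lev k.+1 by rewrite subr_gt0 lev_lt.
  have [q q0 rhoq] := modulus_of_continuity_small rho_mod lev_gap.
  by exists q.
pose K k := T / q k.
have K_gt0 k : 0 < K k by rewrite divr_gt0//; case: (qP k).
have K_ge0 k : 0 <= K k by exact: ltW.
(* For k >= 2, [sigma k] lies between the hitting times of levels k and k + 1, so these times
   interlace and increase. *)
pose sigma k := lipschitz_hitting X (K k) (lev k.+1).
have sigma_ge k w : (2 <= k)%N -> hitting_time X (lev k) w <= sigma k w.
  move=> k2; have [q0 /(_ k2) rhoq] := qP k.
  apply: (hitting_le_lipschitz_hitting T_ge0 w rho_mono X_rho q0 rhoq).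
  by rewrite /K divfK ?gt_eqF.
have sigma_le k w : sigma k w <= hitting_time X (lev k.+1) w.
  exact: lipschitz_hitting_le_hitting.
have sigma_mono w k : (2 <= k)%N -> sigma k w <= sigma k.+1 w.
  by move=> k2; apply: le_trans (sigma_le k w) (sigma_ge _ _ _); exact: leqW.
have sigmaT w k : 0 <= sigma k w <= T.
  rewrite lipschitz_hitting_ge0//=.
  apply: le_trans (sigma_le k w) _. exact: hitting_time_leT.
(* The shift by 2 matches the n + 2 in [level] and turns the step bound 2 T / (m + 1) into 2 T / (n
   + 3). *)
pose wp n w := dyadic_interpolation T (sigma^~ w) (n + 2).
(* The term n gives positivity and divergence; the sum dominates every constant in use, as [wp n]
   involves [sigma] only up to index n + 3. *)
pose kappa n : R := n%:R + \sum_(0 <= j < n + 4) K j.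
have block2 n : (1 <= n)%N -> (2 <= up_log 2 (n + 2))%N.
  move=> n1; rewrite ltnNge; apply/negP => km.
  have := up_logP (n + 2) (isT : (1 < 2)%N); rewrite leqNgt => /negP; apply.
  apply: (@leq_ltn_trans 2); last by rewrite addn2 !ltnS.
  by rewrite -[leqRHS]expn1 leq_exp2l.
have blockE n : (1 <= n)%N -> (up_log 2 (n + 2)).-1.+1 = up_log 2 (n + 2).
  by move=> /block2 k2; rewrite prednK// ltnW.
have wp_step n w : (1 <= n)%N -> 0 <= wp n.+1 w - wp n w <= 2 * T / (n + 3)%:R.
  move=> n1; rewrite /wp addSn [(n + 3)%N]addnS; apply: dyadic_interpolation_step => //.
    by rewrite addn2 !ltnS.
  exact: sigma_mono.
have wp_le n w : wp n w <= sigma (up_log 2 (n + 2)).-1.+2 w.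
  by rewrite ge_min lexx orbT.
have wp_ge n w : (1 <= n)%N -> sigma (up_log 2 (n + 2)) w <= wp n w.
  move=> n1; have := @dyadic_interpolation_ge _ T T_gt0 (sigma^~ w) (n + 2).
  by rewrite blockE//; apply; exact: sigma_mono (block2 n n1).
have wpT n w : (1 <= n)%N -> 0 <= wp n w <= T.
  move=> n1; apply/andP; split.
    by apply: le_trans (wp_ge n w n1); case/andP: (sigmaT w (up_log 2 (n + 2))).
  by apply: le_trans (wp_le n w) _; case/andP: (sigmaT w (up_log 2 (n + 2)).-1.+2).
have kappa_ge n : n%:R <= kappa n by rewrite lerDl sumr_ge0.
have kappa_ge0 n : 0 <= kappa n by exact: le_trans (kappa_ge n).
have K_kappa n j : (j < n + 4)%N -> K j <= kappa n.
  move=> jn; apply: (@le_trans _ _ (\sum_(0 <= i < n + 4) K i)); last by rewrite lerDr.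
  rewrite big_mkord (bigD1 (Ordinal jn))//= lerDl.
  by apply: sumr_ge0.
have wp_causal n : causal_lipschitz (kappa n) (wp n).
  have kn : (up_log 2 (n + 2) <= n + 2)%N.
    by apply: up_log_min => //; rewrite ltnW// ltn_expl.
  have k0 : (0 < up_log 2 (n + 2))%N by rewrite up_log_gt0 addn2.
  have sK j : (j < n + 4)%N -> causal_lipschitz (kappa n) (sigma j).
    move=> jn; apply: causal_lipschitz_le (K_kappa n j jn) _.
    exact: lipschitz_hitting_causal.
  apply: causal_lipschitz_min.
    apply: causal_lipschitzD => //; last first.
      by apply: sK; rewrite prednK// !addnS !ltnS in kn *; exact: leqW.
    by rewrite mulr_ge0// divr_ge0.
  by apply: sK; rewrite prednK// !addnS !ltnS in kn *.
exists wp, kappa; split; [split|] => [n n1|m n w m1|n n1|m n _||n n1].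
- by apply: causal_lipschitz_stopping_time (wp_causal n) => // w; exact: wpT.
- elim: n => [|n IH]; first by rewrite leqn0 => /eqP m0; rewrite m0 in m1.
  rewrite leq_eqVlt => /orP[/eqP ->//|mn]; apply: le_trans (IH mn) _.
  have := wp_step n w (leq_trans m1 mn).
  by rewrite subr_ge0 => /andP[].
- by apply: lt_le_trans (kappa_ge n); rewrite ltr0n.
- apply: (homo_leq (r := fun x y : R => x <= y)) => [//|x y z|{}n].
    exact: le_trans.
  by rewrite lerD ?ler_nat// addSn [leRHS]big_nat_recr//= lerDl.
- apply: ger_cvgy (@cvgr_idn R); exact: nearW kappa_ge.
- have k2 := block2 n n1; split.
  (* With k = up_log 2 (n + 2), tau_n <= sigma k <= wp_n <= sigma (k + 1), which is at most the
     hitting time of level k + 2. *)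
  + move=> w; rewrite /tau_ X0E levelE -/lev.
    rewrite (le_trans (sigma_ge _ _ _) (wp_ge n w n1))//=.
    apply: le_trans (wp_le n w) _; apply: le_trans (sigma_le _ _) _.
    by apply: le_hitting_time_level => //; rewrite ltW// lev_gt0// blockE// ltnW.
  + by move=> w; exact: wp_step.
  (* Level k + 2 is positive, so X meets it strictly before it meets 0. *)
  + move=> w hit; apply: le_lt_trans (wp_le n w) _; apply: le_lt_trans (sigma_le _ _) _.
    by apply: hitting_time_lt => //; rewrite lev_gt0// blockE// ltnW.
  + move=> w1 w2 t a N at0; apply: causal_lipschitz_dist => //.
    case: at0 => [[/andP[]]//|->]; rewrite ge_min.
    by case/andP: (wpT n w1 n1) => _ ->.
Qed.
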